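(* Let $n\ge 2$ and let $\Psi\in\mathbb{C}^{n\times n}$ be a complex symmetric matrix (i.e. a symmetric tensor of order $m=2$ and dimension $n$). Then there exists a symmetric matrix $M\in\mathbb{R}^{2n\times 2n}$ such that a number $\lambda$ is a Q-eigenvalue of $\Psi$ if and only if it is a Z-eigenvalue of $M$. In this case, for $x,y\in\mathbb{R}^n$, $z=x+y\sqrt{-1}$ is a Q-eigenvector of $\Psi$ associated with $\lambda$ if and only if $w=\binom{x}{y}$ is a unit eigenvector of $M$ associated with $\lambda$. Furthermore, the eigenvalues of $M$ appear in pairs, i.e., if $\lambda$ is an eigenvalue of $M$, then $-\lambda$ is also an eigenvalue of $M$.
   Context: Symmetric means $\Psi^\top=\Psi$ (no conjugation). A bar denotes (entrywise) complex conjugation. Q-eigenvalue (quantum eigenvalue), case of order $m=2$: $\lambda$ is a Q-eigenvalue of $\Psi$, with Q-eigenvector $z\in\mathbb{C}^n$, if $\Psi z=\lambda\bar z$, $\bar\Psi\bar z=\lambda z$ and $\bar z^\top z=1$. Such $\lambda$ is necessarily real; equivalently, $\lambda\in\mathbb{R}$, $\Psi z=\lambda\bar z$ and $\bar z^\top z=1$. Z-eigenvalue of a real matrix $M\in\mathbb{R}^{2n\times 2n}$: a real number $\lambda$ for which there is $w\in\mathbb{R}^{2n}$ with $Mw=\lambda w$ and $w^\top w=1$ (so, for a real symmetric matrix, an ordinary eigenvalue). *)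

(* Defs.v *)
From mathcomp Require Import all_boot all_order all_algebra.
From mathcomp Require Import reals.
From mathcomp.real_closed Require Export complex.

Set Implicit Arguments.
Unset Strict Implicit.
Unset Printing Implicit Defensive.

Import GRing.Theory.
Local Open Scope ring_scope.
Local Open Scope complex_scope.

Section Eigenpairs.
Variable R : realType.

Definition conj_mx (m n : nat) (A : 'M[R[i]]_(m, n)) : 'M[R[i]]_(m, n) :=
  map_mx conjc A.

Definition complex_vec (n : nat) (x y : 'cV[R]_n) : 'cV[R[i]]_n :=
  \col_j (x j 0 +i* y j 0).

(* The eigenvalue is a priori complex; the two equations together force it to
   be real. The product in the normalization is a 1 x 1 matrix. *)
Definition Q_eigenpair (n : nat) (Psi : 'M[R[i]]_n) (lambda : R[i])
    (z : 'cV[R[i]]_n) : Prop :=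
  [/\ Psi *m z = lambda *: conj_mx z,
      conj_mx Psi *m conj_mx z = lambda *: z
    & (conj_mx z)^T *m z = 1%:M].

Definition Q_eigenvalue (n : nat) (Psi : 'M[R[i]]_n) (lambda : R[i]) : Prop :=
  exists z : 'cV[R[i]]_n, Q_eigenpair Psi lambda z.

Definition Z_eigenpair (n : nat) (M : 'M[R]_n) (lambda : R)
    (w : 'cV[R]_n) : Prop :=
  M *m w = lambda *: w /\ w^T *m w = 1%:M.

Definition Z_eigenvalue (n : nat) (M : 'M[R]_n) (lambda : R) : Prop :=
  exists w : 'cV[R]_n, Z_eigenpair M lambda w.

End Eigenpairs.

(* Main.v *)
Require Import Defs.
From mathcomp Require Import all_boot all_order all_algebra.
From mathcomp Require Import reals.

Set Implicit Arguments.
Unset Strict Implicit.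
Unset Printing Implicit Defensive.

Import GRing.Theory.
Local Open Scope ring_scope.
Local Open Scope complex_scope.

(* Write [Psi = A + iB] and [z = x + iy]. Separating real and imaginary parts,
   [Psi z = lambda * conj z] says [A x - B y = lambda x] and
   [- B x - A y = lambda y], so [M] is the block matrix [(A, -B; -B, -A)].
   The map [(a, b) |-> (b, -a)], which is multiplication of [z] by [-i],
   anticommutes with [M], hence the symmetry of the spectrum. *)

Section RealForm.
Variables (R : realType) (n : nat).
Implicit Types (Psi : 'M[R[i]]_n) (x y : 'cV[R]_n) (z : 'cV[R[i]]_n).

Definition Re_mx (m p : nat) (A : 'M[R[i]]_(m, p)) : 'M[R]_(m, p) :=
  map_mx (@complex.Re R) A.

Definition Im_mx (m p : nat) (A : 'M[R[i]]_(m, p)) : 'M[R]_(m, p) :=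
  map_mx (@complex.Im R) A.

Definition real_form Psi : 'M[R]_(n + n) :=
  block_mx (Re_mx Psi) (- Im_mx Psi) (- Im_mx Psi) (- Re_mx Psi).

Lemma real_form_sym Psi : Psi^T = Psi -> (real_form Psi)^T = real_form Psi.
Proof.
move=> Psi_sym; rewrite /real_form tr_block_mx !linearN /=.
by rewrite /Re_mx /Im_mx !map_trmx Psi_sym.
Qed.

Lemma complex_vecE z : complex_vec (Re_mx z) (Im_mx z) = z.
Proof. by apply/colP => j; rewrite !mxE; case: (z j 0). Qed.

Lemma complex_vec_inj x y x' y' :
  complex_vec x y = complex_vec x' y' -> x = x' /\ y = y'.
Proof.
by move=> /colP e; split; apply/colP => j; have:= e j; rewrite !mxE => -[].
Qed.

Lemma conj_complex_vec x y : conj_mx (complex_vec x y) = complex_vec x (- y).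
Proof. by apply/colP => j; rewrite !mxE. Qed.

Lemma scale_complex_vec (r : R) x y :
  r%:C *: complex_vec x y = complex_vec (r *: x) (r *: y).
Proof.
apply/colP => j; rewrite !mxE; apply/eqP; rewrite eq_complex /=.
by rewrite !mul0r subr0 addr0 !eqxx.
Qed.

Lemma mul_complex_vec Psi x y :
  Psi *m complex_vec x y =
    complex_vec (Re_mx Psi *m x - Im_mx Psi *m y)
                (Im_mx Psi *m x + Re_mx Psi *m y).
Proof.
apply/colP => j; rewrite !mxE; apply/eqP; rewrite eq_complex /= !raddf_sum /=.
rewrite -!big_split /=; apply/andP; split; apply/eqP/eq_bigr => k _.
  by rewrite !mxE; case: (Psi j k).
by rewrite !mxE; case: (Psi j k) => a b /=; rewrite addrC.
Qed.

Lemma conj_mxK (m p : nat) : involutive (@conj_mx R m p).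
Proof. by move=> A; apply/matrixP => j k; rewrite !mxE conjcK. Qed.

Lemma conj_mxM (m p q : nat) (A : 'M[R[i]]_(m, p)) (B : 'M[R[i]]_(p, q)) :
  conj_mx (A *m B) = conj_mx A *m conj_mx B.
Proof. exact: map_mxM. Qed.

Lemma conj_mxZ (m p : nat) (c : R[i]) (A : 'M[R[i]]_(m, p)) :
  conj_mx (c *: A) = c^* *: conj_mx A.
Proof. exact: map_mxZ. Qed.

(** In [conj(z)^T z] the imaginary parts [x_j y_j - y_j x_j] cancel. The Hermitian product is
    therefore the image of the real [1 x 1] product under the embedding of [R] into [R[i]], which is
    injective and sends 1 to 1. *)
Lemma norm_complex_vec x y :
  (conj_mx (complex_vec x y))^T *m complex_vec x y = 1%:M <->
  (col_mx x y)^T *m col_mx x y = 1%:M.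
Proof.
have -> : (conj_mx (complex_vec x y))^T *m complex_vec x y =
    map_mx (real_complex R) ((col_mx x y)^T *m col_mx x y).
  apply/matrixP => j k; rewrite tr_col_mx mul_row_col !mxE rmorphD !rmorph_sum.
  rewrite -big_split; apply: eq_bigr => l _; rewrite !mxE !ord1.
  apply/eqP; rewrite eq_complex /= mulNr opprK addr0 eqxx /=.
  by rewrite mulNr mulrC subrr.
rewrite -(map_mx1 (real_complex R)); split=> [|-> //].
exact: map_mx_inj.
Qed.

Lemma Q_eigenpair_real_form Psi (r : R) x y :
  Q_eigenpair Psi r%:C (complex_vec x y) <->
  Z_eigenpair (real_form Psi) r (col_mx x y).
Proof.
rewrite /Z_eigenpair /real_form mul_block_col scale_col_mx !mulNmx -opprD.
(* Conjugation turns [y] into [- y], so the imaginary part of the equation is negated to become the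
   lower block row. *)
have eqE : Psi *m complex_vec x y = r%:C *: conj_mx (complex_vec x y) <->
    col_mx (Re_mx Psi *m x - Im_mx Psi *m y)
      (- (Im_mx Psi *m x + Re_mx Psi *m y)) = col_mx (r *: x) (r *: y).
  rewrite mul_complex_vec conj_complex_vec scale_complex_vec scalerN.
  split=> [/complex_vec_inj[-> ->] | /eq_col_mx[-> <-]]; by rewrite opprK.
split=> [[/eqE Psiz _ /norm_complex_vec nz] // | [/eqE Psiz /norm_complex_vec]].
(* The second Q-equation is the conjugate of the first, because [r%:C] is its own conjugate. *)
split=> //; rewrite -conj_mxM Psiz conj_mxZ conj_mxK.
by congr (_ *: _); apply/eqP; rewrite eq_complex /= oppr0 !eqxx.
Qed.

(** Conjugating the first equation and comparing with the second gives [c^* *: z = c *: z]. The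
    normalization excludes [z = 0], so [c^* = c]. *)
Lemma Q_eigenpair_real Psi (c : R[i]) z :
  Q_eigenpair Psi c z -> c = (complex.Re c)%:C.
Proof.
case=> Psiz; rewrite -conj_mxM Psiz conj_mxZ conj_mxK => /eqP.
rewrite -subr_eq0 -scalerBl scaler_eq0 => /orP[|/eqP-> /matrixP/(_ 0 0)/eqP].
  rewrite subr_eq0 eq_complex /= => /andP[_ /eqP].
  (* From [- b = b] follows [b *+ 2 = 0], hence [b = 0]. *)
  by case: c {Psiz} => a b /= /eqP; rewrite eq_sym -addr_eq0 -mulr2n Num.Theory.mulrn_eq0
    => /eqP->.
by rewrite mulmx0 !mxE eqxx eq_sym oner_eq0.
Qed.

(** Here [eigenvalue] is about row vectors, so the rotation acts on the left of [M]: from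
    [a A - b B = r a] and [- a B - b A = r b] one gets [(b, -a) M = (b A + a B, a A - b B) = - r (b,
    -a)]. *)
Lemma real_form_eigenvalueN Psi (r : R) :
  eigenvalue (real_form Psi) r -> eigenvalue (real_form Psi) (- r).
Proof.
case/eigenvalueP => v; rewrite -[v]hsubmxK.
set a := lsubmx v; set b := rsubmx v.
rewrite mul_row_block scale_row_mx => /eq_row_mx[ea eb] nz.
apply/eigenvalueP; exists (row_mx b (- a)); last first.
  apply: contra nz; rewrite -!row_mx0 => /eqP/eq_row_mx[-> /eqP].
  by rewrite oppr_eq0 => /eqP->.
rewrite mul_row_block scale_row_mx !scaleNr scalerN opprK -ea -eb.
by rewrite !(mulNmx, mulmxN) !opprK opprD !opprK addrC [X in row_mx _ X]addrC.
Qed.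

End RealForm.

Theorem theorem4p1 (R : realType) (n : nat) (hn : (2 <= n)%N)
    (Psi : 'M[R[i]]_n) (Psi_sym : Psi^T = Psi) :
  exists M : 'M[R]_(n + n),
    [/\ M^T = M,
        (forall lambda : R[i],
           Q_eigenvalue Psi lambda <->
           exists2 r : R, lambda = r%:C & Z_eigenvalue M r),
        (forall (lambda : R) (x y : 'cV[R]_n),
           Q_eigenpair Psi lambda%:C (complex_vec x y) <->
           Z_eigenpair M lambda (col_mx x y))
      & (forall lambda : R, eigenvalue M lambda -> eigenvalue M (- lambda))].
Proof.
exists (real_form Psi); split.
- exact: real_form_sym.
- move=> c; split=> [[z Qz] | [r -> [w]]].
    have cE := Q_eigenpair_real Qz; exists (complex.Re c) => //.
    exists (col_mx (Re_mx z) (Im_mx z)); apply/Q_eigenpair_real_form.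
    by rewrite -cE complex_vecE.
  (* The upper and lower halves of [w] are the real and imaginary parts of the Q-eigenvector. *)
  by rewrite -[w]vsubmxK => /Q_eigenpair_real_form Qz; eexists; exact: Qz.
- exact: Q_eigenpair_real_form.
- exact: real_form_eigenvalueN.
Qed.
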